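(* Fix $d\ge 2$ and let $\mathbf{p}_1,\dots,\mathbf{p}_n$ be independent points uniformly distributed on $[0,1]^d$. Then the expected number of scalar comparisons used by the sieve version of algorithm Maxima (described in the context) on input $(\mathbf{p}_1,\dots,\mathbf{p}_n)$ is $dn+O\big(n^{1-1/d}(\log n)^{d+1/d}\big)$ as $n\to\infty$.
   Context: For $\mathbf{p},\mathbf{q}\in\mathbb{R}^d$, $\mathbf{q}\prec\mathbf{p}$ ($\mathbf{p}$ dominates $\mathbf{q}$) means all coordinates of $\mathbf{p}-\mathbf{q}$ are nonnegative and $\mathbf{p}\ne\mathbf{q}$; maxima of a set are its non-dominated points; a point of a sequence is a (non-dominated) record if no earlier point of the sequence dominates it. A $k$-d tree stores points in a binary tree where a node at depth $t$ (root at depth $0$) uses coordinate $\ell=(t \bmod d)+1$ as discriminator: a point $\mathbf{p}$ inserted below a node $\mathbf{r}$ with discriminator $\ell$ goes to the right subtree if $p_\ell\ge r_\ell$ and to the left subtree otherwise, becoming a new leaf when the relevant subtree is empty. Each node $\mathbf{r}$ stores the upper bound $\mathbf{u}_{\mathbf{r}}$, the coordinatewise maximum of all points in the subtree rooted at $\mathbf{r}$ (updated along the insertion path on each insertion). The test Dominated$(\mathbf{r},\mathbf{p})$ returns 1 if $\mathbf{p}\prec\mathbf{r}$; otherwise, if $\mathbf{r}$ has a left child $\mathbf{r}_L$ with $\mathbf{p}\prec\mathbf{u}_{\mathbf{r}_L}$ and Dominated$(\mathbf{r}_L,\mathbf{p})=1$ it returns 1; otherwise, if $\mathbf{r}$ has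 a right child $\mathbf{r}_R$ with $\mathbf{p}\prec\mathbf{u}_{\mathbf{r}_R}$ and Dominated$(\mathbf{r}_R,\mathbf{p})=1$ it returns 1; otherwise it returns 0. Algorithm Maxima: Phase 1: start a $k$-d tree with root $\mathbf{p}_1$ and list $R=(\mathbf{p}_1)$; for $i=2,\dots,n$, if Dominated(root, $\mathbf{p}_i$)$=0$, insert $\mathbf{p}_i$ into the tree and append it to $R$. Phase 2: with $R=(\mathbf{q}_1,\dots,\mathbf{q}_k)$, discard the tree, start a new $k$-d tree with root $\mathbf{q}_k$, and for $i=k-1$ down to $1$ insert $\mathbf{q}_i$ if Dominated(root, $\mathbf{q}_i$)$=0$; the final tree holds the maxima. The sieve version modifies Phase 1 as follows: maintain a sieve point $\mathbf{s}$, initially $\mathbf{p}_1$; for each $i\ge2$, first test whether $\mathbf{p}_i\prec\mathbf{s}$; if so, $\mathbf{p}_i$ is discarded; otherwise $\mathbf{s}$ is replaced by $\mathbf{p}_i$ if $\|\mathbf{p}_i\|_1>\|\mathbf{s}\|_1$, and $\mathbf{p}_i$ is then processed as in Phase 1 above. Here $\|\cdot\|_1$ is the $L^1$-norm. *)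

(* Defs.v *)
From HB Require Import structures.
From mathcomp Require Import all_boot all_order all_algebra.
From mathcomp Require Import all_classical all_reals all_analysis.

Set Implicit Arguments.
Unset Strict Implicit.
Unset Printing Implicit Defensive.

Import Order.TTheory GRing.Theory Num.Theory.
Import numFieldNormedType.Exports.

Local Open Scope classical_set_scope.
Local Open Scope ring_scope.

(* A value together with the number of scalar comparisons spent computing it. *)
Definition counted (A : Type) : Type := (A * nat)%type.

Definition ret (A : Type) (x : A) : counted A := (x, 0%N).

Definition charge (A : Type) (k : nat) (m : counted A) : counted A :=
  (m.1, (k + m.2)%N).

Definition bind (A B : Type) (m : counted A) (f : A -> counted B) : counted B :=
  charge m.2 (f m.1).

Notation "'let*' x := m 'in' k" := (bind m (fun x => k))
  (at level 200, x name, m at level 200, k at level 200).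

Fixpoint foldlM (A S : Type) (step : S -> A -> counted S) (s : S) (xs : seq A) :
    counted S :=
  match xs with
  | [::] => ret s
  | x :: xs' => let* s' := step s x in foldlM step s' xs'
  end.

Section Algorithm.
Context (R : realType) (d : nat).
Implicit Types (p q r u s : d.-tuple R).

(* [prec p q] is p ≺ q: q dominates p. *)
Definition prec p q : bool :=
  [forall l : 'I_d, tnth p l <= tnth q l] && (p != q).

(* The coordinates are scanned from first to last with one three-way comparison
   (<, = or >) each, stopping at the first l such that p_l > q_l; the outcomes
   also decide whether p = q.  A test with a positive answer costs exactly d. *)
Definition prec_test p q : counted bool :=
  (prec p q, minn d (find (fun l => tnth q l < tnth p l) (enum 'I_d)).+1).

Definition l1norm p : R := \sum_(l < d) `|tnth p l|.

Definition tmax u p : d.-tuple R :=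
  [tuple Num.max (tnth u l) (tnth p l) | l < d].

(* [Node r u L Rt]: the stored point, the upper bound of the subtree, and the
   left and right subtrees. *)
Inductive kdtree : Type :=
| Empty
| Node of d.-tuple R & d.-tuple R & kdtree & kdtree.

Definition leaf p : kdtree := Node p p Empty Empty.

(* Coordinates are numbered from 0, so the discriminator at depth t is the
   coordinate [t %% d]. *)
Definition coord (t : nat) p : R := nth 0 p (t %% d).

(* [t] is the depth of the root of the subtree in which [p] is inserted.  Each
   node on the insertion path costs one comparison of discriminators, and d
   comparisons to update its upper bound. *)
Fixpoint insert (t : nat) (T : kdtree) p : counted kdtree :=
  match T with
  | Empty => ret (leaf p)
  | Node r u L Rt =>
    charge (1 + d)
      (if coord t r <= coord t p
       then let* Rt' := insert t.+1 Rt p in ret (Node r (tmax u p) L Rt')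
       else let* L' := insert t.+1 L p in ret (Node r (tmax u p) L' Rt))
  end.

(* [search] is the recursive search of the child [c], made only if [c] is
   nonempty and its upper bound dominates [p]. *)
Definition guarded (c : kdtree) p (search : counted bool) : counted bool :=
  match c with
  | Empty => ret false
  | Node _ u _ _ => let* b := prec_test p u in if b then search else ret false
  end.

Fixpoint dominated (T : kdtree) p : counted bool :=
  match T with
  | Empty => ret false
  | Node r _ L Rt =>
    let* b := prec_test p r in
    if b then ret true else
    let* bL := guarded L p (dominated L p) in
    if bL then ret true else
    guarded Rt p (dominated Rt p)
  end.

(* The state consists of the tree, the list of records and the sieve point. *)
Definition phase1_step (st : kdtree * seq (d.-tuple R) * d.-tuple R) p :
    counted (kdtree * seq (d.-tuple R) * d.-tuple R) :=
  let: (T, qs, s) := st in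
  let* b := prec_test p s in
  if b then ret st else
  let* g := (l1norm s < l1norm p, 1%N) in
  let s' := if g then p else s in
  let* bT := dominated T p in
  if bT then ret (T, qs, s') else
  let* T' := insert 0 T p in
  ret (T', rcons qs p, s').

Definition phase2_step (T : kdtree) q : counted kdtree :=
  let* b := dominated T q in
  if b then ret T else insert 0 T q.

Definition phase2 (qs : seq (d.-tuple R)) : counted kdtree :=
  match rev qs with
  | [::] => ret Empty
  | q :: qs' => foldlM phase2_step (leaf q) qs'
  end.

Definition sieve_maxima (ps : seq (d.-tuple R)) : counted kdtree :=
  match ps with
  | [::] => ret Empty
  | p :: ps' =>
    let* st := foldlM phase1_step (leaf p, [:: p], p) ps' in
    phase2 st.1.2
  end.

Definition sieve_maxima_comparisons (ps : seq (d.-tuple R)) : nat :=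
  (sieve_maxima ps).2.

End Algorithm.

Arguments Empty {R d}.

(* Lebesgue measure on R^d, as the d-fold product of Lebesgue measure on R. *)
Fixpoint lebesgue_tuple (R : realType) (d : nat) :
    set (d.-tuple R) -> \bar R :=
  match d return set (d.-tuple R) -> \bar R with
  | 0%N => fun A => \d_([tuple] : 0.-tuple R) A
  | d'.+1 => fun A =>
    ((@lebesgue_measure R) \x (@lebesgue_tuple R d'))%E
      [set xt : R * d'.-tuple R | A [tuple of xt.1 :: xt.2]]
  end.

Definition unit_cube (R : realType) (d : nat) : set (d.-tuple R) :=
  [set x | forall l : 'I_d, 0 <= tnth x l <= 1].

Arguments unit_cube R d : clear implicits.

Section Probability.
Context (R : realType) (dO : measure_display) (Omega : measurableType dO)
  (P : probability Omega R).

Definition uniform_on_cube (d : nat) (X : {RV P >-> d.-tuple R}) : Prop :=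
  forall A : set (d.-tuple R), measurable A ->
    distribution P X A = lebesgue_tuple (A `&` unit_cube R d).

Definition mutually_independent (dT : measure_display) (T : measurableType dT)
    (n : nat) (X : 'I_n -> {RV P >-> T}) : Prop :=
  forall (J : {set 'I_n}) (A : 'I_n -> set T),
    (forall i, i \in J -> measurable (A i)) ->
    P [set w | forall i, i \in J -> A i (X i w)] =
    (\prod_(i in J) P (X i @^-1` A i))%E.

End Probability.

(* Main.v *)
(* A point p_j that is dominated by the sieve point costs exactly d comparisons.  Any
   other point costs O(K) comparisons, K being the number of records among
   p_1, ..., p_(j-1), even if the whole tree is visited, and Phase 2 costs O(K^2), which
   is paid by O(K) per record since records survive the sieve.  It remains to bound the
   sum over j of E[1{p_j survives} K_j].  With t_j = (2 ln n / j)^(1/d), some earlier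
   point lies in [1 - t_j, 1]^d except with probability at most n^-2; the sieve point,
   maximizing the L1-norm, then has all coordinates at least 1 - d t_j, so p_j survives
   only outside [0, 1 - d t_j)^d, an event of probability at most d^2 t_j which is
   independent of the earlier points.  Covering the cube by dyadic cells gives
   E[K_j] = O((ln n)^d), and summing t_j over j gives n^(1-1/d) (ln n)^(1/d). *)

Require Import Defs.
From HB Require Import structures.
From mathcomp Require Import all_boot all_order all_algebra.
From mathcomp Require Import all_classical all_reals all_analysis.
From mathcomp Require Import zify ring lra.

Set Implicit Arguments.
Unset Strict Implicit.
Unset Printing Implicit Defensive.

Import Order.TTheory GRing.Theory Num.Theory.
Import numFieldNormedType.Exports.

Local Open Scope classical_set_scope.
Local Open Scope ring_scope.

Lemma foldlM_rcons (A S : Type) (step : S -> A -> counted S) s xs x :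
  foldlM step s (rcons xs x) = let* s' := foldlM step s xs in step s' x.
Proof.
elim: xs s => [|y ys IH] s /=; rewrite /bind /Defs.charge /= ?addn0 ?add0n; first by case: (step s x).
by rewrite IH /bind /Defs.charge /= addnA.
Qed.

(** * Deterministic cost bounds *)

Section Counting.
Context (R : realType) (d : nat).
Implicit Types (p q r u s x : d.-tuple R) (T : kdtree R d) (xs ps : seq (d.-tuple R)).

Definition ple p q : bool := [forall l, tnth p l <= tnth q l].

Lemma ple_refl p : ple p p.
Proof. by apply/forallP. Qed.

Lemma ple_trans q p r : ple p q -> ple q r -> ple p r.
Proof.
by move=> /forallP pq /forallP qr; apply/forallP => l; apply: le_trans (qr l).
Qed.

Lemma ple_anti p q : ple p q -> ple q p -> p = q.
Proof.
move=> /forallP pq /forallP qp; apply: eq_from_tnth => l.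
by apply/eqP; rewrite eq_le pq qp.
Qed.

Lemma precE p q : prec p q = ple p q && (p != q).
Proof. by []. Qed.

Lemma prec_ple_trans p q r : prec p q -> ple q r -> prec p r.
Proof.
rewrite !precE => /andP[pq pNq] qr; rewrite (ple_trans pq qr)/=.
by apply: contraNneq pNq => pr; rewrite pr in pq *; apply/eqP/ple_anti.
Qed.

Lemma prec_trans q p r : prec p q -> prec q r -> prec p r.
Proof. by move=> pq /andP[qr _]; apply: prec_ple_trans qr. Qed.

Lemma ple_tmaxl u p : ple u (tmax u p).
Proof. by apply/forallP => l; rewrite tnth_mktuple le_max lexx. Qed.

Lemma ple_tmaxr u p : ple p (tmax u p).
Proof. by apply/forallP => l; rewrite tnth_mktuple le_max lexx orbT. Qed.

Fixpoint pts T : seq (d.-tuple R) :=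
  if T is Node r _ L Rt then r :: pts L ++ pts Rt else [::].

(** Each stored bound is only required to lie above the points of its subtree; that is all pruning
    needs. *)
Fixpoint bounds_ok T : bool :=
  if T is Node _ u L Rt then
    [&& all (ple^~ u) (pts T), bounds_ok L & bounds_ok Rt]
  else true.

Lemma prec_test_cost_le p q : ((prec_test p q).2 <= d)%N.
Proof. exact: geq_minl. Qed.

Lemma prec_test_cost p q : prec p q -> (prec_test p q).2 = d.
Proof.
move=> /andP[/forallP pq _]; apply/minn_idPl.
rewrite hasNfind ?size_enum_ord//; apply/hasPn => l _.
by rewrite -leNgt.
Qed.

(** Pruning loses nothing: if [x] dominates [p] and [u] lies above [x], then [u] dominates [p], so a
    skipped child holds no dominating point. *)
Lemma dominatedE T p : bounds_ok T -> (dominated T p).1 = has (prec p) (pts T).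
Proof.
have guardedE c : bounds_ok c ->
    (dominated c p).1 = has (prec p) (pts c) ->
    (guarded c p (dominated c p)).1 = has (prec p) (pts c).
  case: c => [//|r u L Rt] /and3P[/allP ub _ _] IH.
  rewrite /guarded /bind /Defs.charge/=; case: ifPn => // /negP pNu.
  apply/esym/negbTE.
  rewrite -[_ || _]/(has (prec p) (pts (Node r u L Rt))).
  apply/hasPn => x xT; apply/negP => px; apply: pNu.
  exact: prec_ple_trans px (ub _ xT).
elim: T => [//|r u L IHL Rt IHR] /= /and3P[_ okL okR].
rewrite has_cat -(guardedE L) ?IHL// -(guardedE Rt) ?IHR//.
by case: (prec p r) => //=; case: (guarded L p _).1.
Qed.

Lemma dominated_cost T p : ((dominated T p).2 <= 2 * d * size (pts T))%N.
Proof.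
(* Every node is charged for two tests, against its point and against its bound. The bound of the
   root is not tested, and the [d] saved there pays for the guard when the tree is a child. *)
suff H : T = Defs.Empty \/ ((dominated T p).2 + d <= 2 * d * size (pts T))%N.
  by case: H => [->//|]; lia.
elim: T => [|r u L IHL Rt IHR]; [by left|right].
have guarded_cost c :
    c = Defs.Empty \/ ((dominated c p).2 + d <= 2 * d * size (pts c))%N ->
    ((guarded c p (dominated c p)).2 <= 2 * d * size (pts c))%N.
  case: c => [//|r' u' L' R'] [//|H].
  have := prec_test_cost_le p u'; move: H.
  by rewrite /guarded /bind /Defs.charge; case: (prec_test p u').1; rewrite /=; lia.
have := guarded_cost _ IHL; have := guarded_cost _ IHR.
have := prec_test_cost_le p r.
rewrite [dominated (Node _ _ _ _) _]/= /bind /Defs.charge [pts (Node _ _ _ _)]/= [size (_ :: _)]/= size_cat.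
case: (prec_test p r).1; first by rewrite /=; nia.
case: (guarded L p _).1; rewrite /=; nia.
Qed.

Lemma insert_pts t T p : perm_eq (pts (insert t T p).1) (p :: pts T).
Proof.
elim: T t => [//|r u L IHL Rt IHR] t; apply/permP => a.
have /permP/(_ a) := IHL t.+1; have /permP/(_ a) := IHR t.+1.
by rewrite /= /bind /Defs.charge/=; case: ifP => _ /=; rewrite !count_cat /=; lia.
Qed.

Lemma insert_bounds t T p : bounds_ok T -> bounds_ok (insert t T p).1.
Proof.
elim: T t => [|r u L IHL Rt IHR] t; first by move=> _; rewrite /= ple_refl.
move=> okT; have /and3P[/allP ub _ _] := okT.
have [okL okR] : bounds_ok L /\ bounds_ok Rt by case/and3P: okT.
suff : all (ple^~ (tmax u p)) (pts (insert t (Node r u L Rt) p).1).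
  have {}IHL := IHL t.+1 okL; have {}IHR := IHR t.+1 okR.
  by rewrite /= /bind /Defs.charge /=; case: ifP => _ /= ->; rewrite ?okL ?okR ?IHL ?IHR.
apply/allP => x; rewrite (perm_mem (insert_pts _ _ _)) inE => /predU1P[->|xT].
  exact: ple_tmaxr.
exact: ple_trans (ub _ xT) (ple_tmaxl _ _).
Qed.

Lemma insert_cost t T p : ((insert t T p).2 <= (1 + d) * size (pts T))%N.
Proof.
elim: T t => [//|r u L IHL Rt IHR] t.
rewrite /= size_cat /Defs.charge /bind /=.
by case: ifP => _ /=; [have := IHR t.+1|have := IHL t.+1]; nia.
Qed.

Lemma size_insert t T p : size (pts (insert t T p).1) = (size (pts T)).+1.
Proof. by rewrite (perm_size (insert_pts t T p)). Qed.

(** A step costs at most [2 * d] per stored point for the dominance test and [1 + d] per stored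
    point for the insertion; the tree never exceeds [size (pts T) + size xs] points. *)
Lemma phase2_cost T xs :
  ((foldlM (@phase2_step R d) T xs).2
    <= (3 * d + 1) * (size xs * (size (pts T) + size xs)))%N.
Proof.
elim: xs T => [//|x xs IH] T.
have step : ((phase2_step T x).2 <= (3 * d + 1) * size (pts T))%N /\
    (size (pts (phase2_step T x).1) <= (size (pts T)).+1)%N.
  have := dominated_cost T x; have := insert_cost 0 T x; have := size_insert 0 T x.
  rewrite /phase2_step /bind /Defs.charge; case: (dominated T x).1; rewrite /=; nia.
have := IH (phase2_step T x).1; move: step.
by rewrite /= /bind /Defs.charge /=; nia.
Qed.

Lemma ple_l1norm p q : (forall l, 0 <= tnth p l) -> ple p q -> l1norm p <= l1norm q.
Proof.
move=> p0 /forallP pq; apply: ler_sum => l _.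
by rewrite !ger0_norm//; apply: le_trans (pq l).
Qed.

(** * Records and the invariant of Phase 1 *)

Definition record ps i : bool := ~~ has (prec (nth [tuple 0 | _ < d] ps i)) (take i ps).

Definition nrecords ps j : nat := \sum_(i < j) record ps i.

(** [inv_cover] links the list to records: by transitivity a point dominated by any earlier point is
    dominated by a listed one, so only records are appended. The sieve point is merely known to have
    occurred, not to be listed. *)
Record phase1_inv ps m (st : kdtree R d * seq (d.-tuple R) * d.-tuple R) : Prop :=
  Phase1Inv {
    inv_bounds : bounds_ok st.1.1;
    inv_pts : pts st.1.1 =i st.1.2;
    inv_size : size (pts st.1.1) = size st.1.2;
    inv_pos : (0 < size st.1.2)%N;
    inv_records : (size st.1.2 <= nrecords ps m)%N;
    inv_cover : {in take m ps, forall x,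
      (x \in st.1.2) || has (prec x) st.1.2};
    inv_sieve : st.2 \in take m ps;
    inv_l1 : {in take m ps, forall x l, 0 <= tnth x l} ->
      {in take m ps, forall x, l1norm x <= l1norm st.2}
  }.

Lemma phase1_step_inv ps m st : (m < size ps)%N -> phase1_inv ps m st ->
  phase1_inv ps m.+1 (phase1_step st (nth [tuple 0 | _ < d] ps m)).1.
Proof.
move=> mps; set x := nth _ ps m.
have takeE : take m.+1 ps = rcons (take m ps) x by rewrite -take_nth.
have nrecE : nrecords ps m.+1 = (nrecords ps m + record ps m)%N.
  by rewrite /nrecords big_ord_recr.
case: st => [[T qs] s] []/= okT Tqs sT qs0 Kle cov sin sl1.
have l1step (s' : d.-tuple R) : l1norm s <= l1norm s' ->
    ({in take m.+1 ps, forall y l, 0 <= tnth y l} -> l1norm x <= l1norm s') ->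
    {in take m.+1 ps, forall y l, 0 <= tnth y l} ->
    {in take m.+1 ps, forall y, l1norm y <= l1norm s'}.
  move=> ss' xs' h y; rewrite takeE mem_rcons inE => /predU1P[->|yin]; first exact: xs'.
  apply: le_trans ss'; apply: sl1 => // z zin; apply: h.
  by rewrite takeE mem_rcons inE zin orbT.
have covstep (P : seq (d.-tuple R)) : {subset qs <= P} ->
    (x \in P) || has (prec x) P -> {in take m.+1 ps, forall y, (y \in P) || has (prec y) P}.
  move=> qsP xP y; rewrite takeE mem_rcons inE => /predU1P[->//|yin].
  have /orP[/qsP->//|/hasP[z /qsP zP yz]] := cov _ yin.
  by apply/orP; right; apply/hasP; exists z.
(* Used twice: with [y] the sieve point, to keep the cover when [x] is discarded, and with [y] any
   earlier point, to see that an inserted [x] is a record. *)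
have dom y : prec x y -> (y \in qs) || has (prec y) qs -> has (prec x) qs.
  move=> xy /orP[yq|/hasP[z zq yz]]; apply/hasP; first by exists y.
  by exists z => //; apply: prec_trans yz.
rewrite /phase1_step /bind /Defs.charge /=.
case: (boolP (prec x s)) => [xs|xNs].
  split => //=; first by rewrite nrecE; lia.
  - by apply: covstep => //; rewrite (dom s xs (cov _ sin)) orbT.
  - by rewrite takeE mem_rcons inE sin orbT.
  apply: l1step => // h; apply: ple_l1norm; last by case/andP: xs.
  by apply: h; rewrite takeE mem_rcons mem_head.
set s' := if _ then x else s.
have s'in : s' \in take m.+1 ps.
  by rewrite takeE mem_rcons inE /s'; case: ifP; rewrite ?eqxx// sin orbT.
have s'l1 : {in take m.+1 ps, forall y l, 0 <= tnth y l} ->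
    {in take m.+1 ps, forall y, l1norm y <= l1norm s'}.
  by apply: l1step; rewrite /s'; case: ltP => // /ltW.
rewrite dominatedE// (eq_has_r Tqs).
case: (boolP (has _ _)) => xT.
  split => //=; first by rewrite nrecE; lia.
  by apply: covstep => //; rewrite xT orbT.
have xrec : record ps m.
  apply: contraNN xT => /hasP[y yin xy].
  exact: dom xy (cov _ yin).
have memT := perm_mem (insert_pts 0 T x).
split; rewrite /= ?size_insert ?size_rcons ?sT//.
- exact: insert_bounds.
- by move=> y; rewrite memT mem_rcons !inE Tqs.
- by rewrite nrecE xrec; lia.
- apply: covstep; last by rewrite mem_rcons mem_head.
  by move=> y yq; rewrite mem_rcons inE yq orbT.
Qed.

(* The potential (3d+1) K^2, K being the number of records stored so far, prepays
   Phase 2. *)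
Lemma phase1_step_cost ps m st x : phase1_inv ps m st ->
  ((phase1_step st x).2 + (3 * d + 1) * size (phase1_step st x).1.1.2 ^ 2
    <= (3 * d + 1) * size st.1.2 ^ 2 + d
       + (12 * d + 5) * (~~ prec x st.2 * size st.1.2))%N /\
  (d * prec x st.2 <= (phase1_step st x).2)%N.
Proof.
case: st => [[T qs] s] []/= _ _ sT qs0 _ _ _ _.
have := dominated_cost T x; have := insert_cost 0 T x.
have := prec_test_cost_le x s; have := @prec_test_cost x s.
rewrite /phase1_step /bind /Defs.charge /= -/(prec_test _ _) sT.
case: (prec x s) => /=; first by move=> /(_ isT); rewrite /prec_test/=; lia.
(* With K stored points, the tree test and the insertion cost at most (3d+1)K, the potential grows
   by (3d+1)(2K+1), and comparing norms costs 1. As K >= 1, the sum is at most (12d+5)K. *)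
move=> _; case: (dominated T x).1 => /=; rewrite /prec_test/= ?size_rcons; nia.
Qed.

(* [bad j] has to hold whenever the j-th point may survive the sieve; maximality of the
   L1-norm characterizes the sieve point only among points with nonnegative coordinates. *)
Definition sieve_hyp ps (bad : nat -> bool) := forall j, (0 < j < size ps)%N -> ~~ bad j ->
  {in take j ps, forall x l, 0 <= tnth x l} /\
  forall s, s \in take j ps -> {in take j ps, forall x, l1norm x <= l1norm s} ->
    prec (nth [tuple 0 | _ < d] ps j) s.

(** Induction on the number [m] of points processed after [p], which have indices 1 to [m] in
    [p :: ps]. A point that is not bad is dominated by the sieve point and costs exactly [d]. The
    summand [3 * d + 1] is the potential of the initial list [[:: p]]. *)
Lemma phase1_cost p ps (bad : nat -> bool) : sieve_hyp (p :: ps) bad ->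
  forall m, (m <= size ps)%N ->
  let run := foldlM (@phase1_step R d) (leaf p, [:: p], p) (take m ps) in
  [/\ phase1_inv (p :: ps) m.+1 run.1,
     (run.2 + (3 * d + 1) * size run.1.1.2 ^ 2 <= (3 * d + 1) + d * m
       + (12 * d + 5) * \sum_(1 <= j < m.+1) bad j * nrecords (p :: ps) j)%N &
     (d * m <= run.2 + d * \sum_(1 <= j < m.+1) bad j)%N].
Proof.
move=> H; elim=> [_|m IH mps].
  rewrite take0 /= !big_geq// muln0 addn0 muln0 addn0; split => //=; last by lia.
  split=> //=; rewrite ?ple_refl ?take0//.
  - by rewrite /nrecords big_ord_recl big_ord0 /record /=.
  - by move=> x xp; rewrite xp.
  - by rewrite mem_head.
  - by move=> _ x; rewrite inE => /eqP->.
have {IH} := IH (ltnW mps); rewrite (take_nth [tuple 0 | _ < d])// foldlM_rcons.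
set run := foldlM _ _ _ => /=; set x := nth _ ps m => -[inv up lo].
have [cst1 cst2] := phase1_step_cost x inv.
have bE : ~~ bad m.+1 -> prec x run.1.2.
  move=> /H[//|pos]; apply; first exact: inv_sieve inv.
  exact: (inv_l1 inv).
have Kle := inv_records inv.
split.
- exact: (@phase1_step_inv (p :: ps) m.+1 run.1).
- rewrite /bind /Defs.charge/= big_nat_recr//=.
  move: bE cst1; case: (bad m.+1) => [_|/(_ isT)->]; [case: (prec x _)|]; rewrite /=; nia.
- rewrite /bind /Defs.charge/= big_nat_recr//=.
  move: bE cst2; case: (bad m.+1) => [_|/(_ isT)->]; [case: (prec x _)|]; rewrite /=; nia.
Qed.

Lemma nrecords_gt0 p ps j : (0 < j)%N -> (0 < nrecords (p :: ps) j)%N.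
Proof. by case: j => // j _; rewrite /nrecords big_ord_recl /record /=. Qed.

(** The 1 in [err] covers the initial potential and the [d] comparisons that [d * size ps] counts
    for the first point, which costs nothing in Phase 1. *)
Lemma sieve_maxima_cost ps (bad : nat -> bool) : sieve_hyp ps bad ->
  let err := ((12 * d + 5) * (1 + \sum_(1 <= j < size ps) bad j * nrecords ps j))%N in
  (sieve_maxima_comparisons ps <= d * size ps + err)%N /\
  (d * size ps <= sieve_maxima_comparisons ps + err)%N.
Proof.
case: ps => [|p ps] H; first by rewrite /= /sieve_maxima_comparisons/=; lia.
have := phase1_cost H (leqnn (size ps)); rewrite take_size /=.
rewrite /sieve_maxima_comparisons /= /bind /Defs.charge /=.
set run := foldlM _ _ _ => -[inv up lo].
(* The final potential covers Phase 2: with K listed points, K - 1 are processed at a cost of at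
   most (3d+1)K each. *)
have : ((phase2 run.1.1.2).2 <= (3 * d + 1) * size run.1.1.2 ^ 2)%N.
  have := inv_pos inv; rewrite /phase2 -(size_rev run.1.1.2).
  case: (rev _) => [//|q qs] _; have := phase2_cost (leaf q) qs; rewrite /=; nia.
(* The lower bound loses [d] per bad index; since the first point is a record, the weighted sum
   absorbs this. *)
have : (\sum_(1 <= j < (size ps).+1) bad j <=
    \sum_(1 <= j < (size ps).+1) bad j * nrecords (p :: ps) j)%N.
  rewrite big_nat_cond [leqRHS]big_nat_cond; apply: leq_sum => j; rewrite andbT => /andP[j0 _].
  by rewrite leq_pmulr// nrecords_gt0.
by nia.
Qed.

End Counting.

(** * Means of possibly nonmeasurable functions *)

Section UpperMean.
Context (R : realType) (dO : measure_display) (Omega : measurableType dO)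
  (P : probability Omega R).
Implicit Types (f g : Omega -> R) (c : R).

(* An upper bound on the mean that makes sense without measurability of f. *)
Definition mean_le f c := exists g, [/\ measurable_fun [set: Omega] g,
  forall w, 0 <= g w, forall w, f w <= g w & (\int[P]_w (g w)%:E <= c%:E)%E].

Lemma mean_le_mono f g c c' : (forall w, f w <= g w) -> c <= c' ->
  mean_le g c -> mean_le f c'.
Proof.
move=> fg cc' [h [mh h0 gh hc]]; exists h; split=> //.
  by move=> w; apply: le_trans (gh w).
by apply: le_trans hc _; rewrite lee_fin.
Qed.

Lemma mean_le_cst c : 0 <= c -> mean_le (fun=> c) c.
Proof.
move=> c0; exists (fun=> c); split=> //.
by rewrite integral_cst//= probability_setT mule1.
Qed.

Lemma mean_leD f g a b : mean_le f a -> mean_le g b ->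
  mean_le (fun w => f w + g w) (a + b).
Proof.
move=> [f' [mf f0 ff' fa]] [g' [mg g0 gg' gb]].
exists (fun w => f' w + g' w); split.
- exact: measurable_realfun.measurable_funD.
- by move=> w; rewrite addr_ge0.
- by move=> w; rewrite lerD.
under eq_integral do rewrite EFinD.
rewrite ge0_integralD//=; first by rewrite EFinD leeD.
- by move=> x _; rewrite lee_fin.
- exact/measurable_realfun.measurable_EFinP.
- by move=> x _; rewrite lee_fin.
- exact/measurable_realfun.measurable_EFinP.
Qed.

Lemma mean_leZ k f c : 0 <= k -> mean_le f c -> mean_le (fun w => k * f w) (k * c).
Proof.
move=> k0 [f' [mf f0 ff' fc]].
exists (fun w => k * f' w); split.
- exact: measurable_realfun.measurable_funM.
- by move=> w; rewrite mulr_ge0.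
- by move=> w; rewrite ler_wpM2l.
under eq_integral do rewrite EFinM.
rewrite ge0_integralZl//=; first by rewrite EFinM lee_wpmul2l.
- exact/measurable_realfun.measurable_EFinP.
- by move=> x _; rewrite lee_fin.
Qed.

Lemma mean_le_sum (I : Type) (r : seq I) (Q : pred I) (f : I -> Omega -> R) (c : I -> R) :
  (forall i, Q i -> mean_le (f i) (c i)) ->
  mean_le (fun w => \sum_(i <- r | Q i) f i w) (\sum_(i <- r | Q i) c i).
Proof.
move=> H; elim: r => [|i r IH].
  rewrite big_nil; under eq_fun do rewrite big_nil; exact: mean_le_cst.
rewrite big_cons; under eq_fun do rewrite big_cons.
by case: ifP => // Qi; apply: mean_leD => //; apply: H.
Qed.

Lemma mean_le_event (b : pred Omega) (A : set Omega) c : measurable A ->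
  (forall w, b w -> A w) -> (P A <= c%:E)%E -> mean_le (fun w => (b w)%:R) c.
Proof.
move=> mA bA PA; exists (\1_A); split.
- exact: measurable_realfun.measurable_indic.
- by move=> w; rewrite indicE ler0n.
- by move=> w; rewrite indicE ler_nat; case: (b w) (bA w) => // /(_ isT)/mem_set->.
by rewrite integral_indic// setIT.
Qed.

(** The integral of a nonnegative function is a supremum over the simple functions below it, hence
    monotone even for nonmeasurable [f] and [g]. *)
Lemma le_expectation f g : (forall w, 0 <= f w) -> (forall w, f w <= g w) ->
  ('E_P[f] <= 'E_P[g])%E.
Proof.
move=> f0 fg; rewrite unlock !ge0_integralTE.
- apply: le_ereal_sup => _ [h /= hf <-]; exists h => // w.
  by apply: le_trans (hf w) _; rewrite lee_fin.
- by move=> w; rewrite lee_fin; apply: le_trans (fg w).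
- by move=> w; rewrite lee_fin.
Qed.

(** With [g] a measurable bound of the deviation, [f] lies between the measurable functions
    [Num.max 0 (a - g w)] and [a + g w]. Truncation at 0 keeps the lower one nonnegative, so that
    [le_expectation] applies to it. *)
Lemma expectation_dist f a c : (forall w, 0 <= f w) -> 0 <= a ->
  mean_le (fun w => `|f w - a|) c -> (`|'E_P[f] - a%:E| <= c%:E)%E.
Proof.
move=> f0 a0 [g [mg g0 fg gc]].
have gint : (0 <= \int[P]_w (g w)%:E)%E by apply: integral_ge0 => w _; rewrite lee_fin.
have gfin : (\int[P]_w (g w)%:E)%E \is a fin_num.
  by rewrite ge0_fin_numE//; apply: le_lt_trans gc (ltry _).
have up : ('E_P[f] <= a%:E + \int[P]_w (g w)%:E)%E.
  have fag w : f w <= a + g w by move: (fg w); rewrite ler_norml; lra.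
  apply: (le_trans (le_expectation f0 fag)).
  rewrite unlock; under eq_integral do rewrite EFinD.
  rewrite ge0_integralD//=.
  - by rewrite integral_cst//= probability_setT mule1.
  - by move=> x _; rewrite lee_fin.
  - exact/measurable_realfun.measurable_EFinP.
have lo : (a%:E <= 'E_P[f] + \int[P]_w (g w)%:E)%E.
  pose l w := Num.max 0 (a - g w).
  have l0 w : 0 <= l w by rewrite le_max lexx.
  have ml : measurable_fun [set: Omega] l by apply: measurable_realfun.measurable_maxr => //; apply: measurable_realfun.measurable_funB.
  have lf w : l w <= f w by rewrite ge_max f0/=; move: (fg w); rewrite ler_norml; lra.
  apply: (@le_trans _ _ ('E_P[l] + \int[P]_w (g w)%:E)%E); last first.
    by rewrite leeD2r// le_expectation.
  rewrite unlock -ge0_integralD//=.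
  - rewrite -[leLHS]mule1 -(probability_setT P) -integral_cst//.
    apply: ge0_le_integral => //=.
    + apply/measurable_realfun.measurable_EFinP; exact: measurable_realfun.measurable_funD.
    + by move=> x _; rewrite -EFinD lee_fin -lerBlDr le_max lexx orbT.
  - by move=> x _; rewrite lee_fin.
  - exact/measurable_realfun.measurable_EFinP.
  - by move=> x _; rewrite lee_fin.
  - exact/measurable_realfun.measurable_EFinP.
have Ef0 : (0 <= 'E_P[f])%E by rewrite unlock; apply: integral_ge0 => w _; rewrite lee_fin.
have Efin : 'E_P[f]%E \is a fin_num.
  rewrite ge0_fin_numE//; apply: le_lt_trans up _.
  by rewrite -(fineK gfin) -EFinD ltry.
move: up lo gc; rewrite -(fineK gfin) -(fineK Efin) -!EFinD -?EFinB /= !lee_fin ler_norml.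
by move=> *; lra.
Qed.

End UpperMean.

(** * Independent uniform points and boxes *)

Section Boxes.
Context (R : realType).

Definition in_box d (I : 'I_d -> interval R) (x : d.-tuple R) : bool :=
  [forall l, tnth x l \in I l].

Lemma measurable_in_box d (I : 'I_d -> interval R) :
  measurable [set x | in_box I x].
Proof.
have -> : [set x | in_box I x] =
    \big[setI/setT]_(l < d) ((fun x => tnth x l) @^-1` [set` I l]).
  rewrite -bigcap_seq; apply/seteqP; split => x /=.
    by move=> /forallP xI l _ /=.
  by move=> xI; apply/forallP => l; apply: xI; rewrite /= mem_index_enum.
apply: bigsetI_measurable => l _; rewrite -[X in measurable X]setTI.
exact: measurable_tnth.
Qed.

Lemma lebesgue_tuple_set0 d : lebesgue_tuple (set0 : set (d.-tuple R)) = 0%E.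
Proof.
elim: d => [|d IH] /=; first by rewrite dirac0.
rewrite /product_measure1 integral0_eq// => x _ /=.
by rewrite -[RHS]IH; congr lebesgue_tuple; apply/seteqP; split => // y; rewrite /xsection /= inE.
Qed.

(** Induction on [d]: the section of the box at [x] is the box of the remaining coordinates if [x]
    lies in the first interval and empty otherwise, so the integrand is a constant times an
    indicator. *)
Lemma lebesgue_tuple_box d (I : 'I_d -> interval R) (v : 'I_d -> R) :
  (forall l, lebesgue_measure [set` I l] = (v l)%:E) ->
  lebesgue_tuple [set x | in_box I x] = (\prod_(l < d) v l)%:E.
Proof.
elim: d I v => [|d IH] I v vE /=.
  by rewrite big_ord0 diracE mem_set//=; apply/forallP => -[].
pose J l := I (lift ord0 l).
have JE := IH J (fun l => v (lift ord0 l)) (fun l => vE _).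
have v0 l : 0 <= v l by rewrite -lee_fin -vE.
rewrite /product_measure1 big_ord_recl mulrC EFinM -vE -[[set` I ord0]]setIT.
rewrite -integral_indic//= -ge0_integralZl//=; last first.
- by rewrite lee_fin prodr_ge0.
- by apply/measurable_realfun.measurable_EFinP; apply: measurable_realfun.measurable_indic.
apply: eq_integral => x _ /=.
rewrite indicE; case: (boolP (x \in I ord0)) => xI.
  rewrite mem_set// mule1 -JE; congr lebesgue_tuple.
  apply/seteqP; split => y; rewrite /xsection /= inE/=.
    move=> /forallP H; apply/forallP => l.
    by have := H (lift ord0 l); rewrite tnthS.
  move=> /forallP H; apply/forallP => l.
  by case: (unliftP ord0 l) => [k ->|->]; rewrite ?tnthS ?tnth0.
rewrite memNset ?mule0; last exact/negP.
rewrite -(lebesgue_tuple_set0 d); congr lebesgue_tuple.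
apply/seteqP; split => y //; rewrite /xsection /= inE/= => /forallP/(_ ord0).
by rewrite tnth0 (negbTE xI).
Qed.

End Boxes.

(** * Product events for an independent uniform sample *)

Section UniformSample.
Context (R : realType) (dO : measure_display) (Omega : measurableType dO)
  (P : probability Omega R) (d n : nat) (X : 'I_n -> {RV P >-> d.-tuple R}).
Hypothesis (indX : mutually_independent X)
  (unifX : forall i, uniform_on_cube (X i)).

Definition has_prob (Q : pred (d.-tuple R)) (q : R) : Prop :=
  measurable [set x | Q x] /\ forall i, P (X i @^-1` [set x | Q x]) = q%:E.

Lemma has_prob_true : has_prob xpredT 1.
Proof.
rewrite /has_prob (_ : mkset _ = [set: d.-tuple R]); last by apply/seteqP; split.
by split => // i; rewrite preimage_setT probability_setT.
Qed.

Lemma has_prob_box (I : 'I_d -> interval R) (v : 'I_d -> R) :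
  (forall l x, x \in I l -> 0 <= x <= 1) ->
  (forall l, lebesgue_measure [set` I l] = (v l)%:E) ->
  has_prob (in_box I) (\prod_(l < d) v l).
Proof.
move=> I01 vE; split => [|i]; first exact: measurable_in_box.
rewrite -(lebesgue_tuple_box vE); have := unifX i (measurable_in_box I).
rewrite /distribution /pushforward => ->; congr lebesgue_tuple.
apply/seteqP; split => [x []//|x /= xI]; split => // l.
exact: I01 (forallP xI l).
Qed.

Lemma has_probN Q q : has_prob Q q -> has_prob (predC Q) (1 - q).
Proof.
rewrite {2}/has_prob (_ : mkset _ = ~` [set x | Q x]); last first.
  by apply/seteqP; split => x /= /negP.
move=> [mQ Qq]; split => [|i]; first exact: measurableC.
by rewrite preimage_setC (probability_setC P (measurable_funPTI (X i) mQ)) Qq.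
Qed.

(** Independence is applied to the full index set; events on fewer indices are obtained by putting
    [xpredT], of probability 1, at the others. *)
Lemma mean_le_forall (Q : 'I_n -> pred (d.-tuple R)) (q : 'I_n -> R) :
  (forall i, has_prob (Q i) (q i)) ->
  mean_le P (fun w => [forall i, Q i (X i w)]%:R) (\prod_(i < n) q i).
Proof.
move=> Qq.
have mQ i : measurable [set x | Q i x] by case: (Qq i).
apply: (@mean_le_event _ _ _ _ _ [set w | forall i, i \in [set: 'I_n]%SET ->
    [set x | Q i x] (X i w)]).
- have -> : [set w | forall i, i \in [set: 'I_n]%SET -> [set x | Q i x] (X i w)] =
     \big[setI/setT]_(i < n) (X i @^-1` [set x | Q i x]).
    rewrite -bigcap_seq; apply/seteqP; split => w /= H i.
      by move=> _; apply: H; rewrite inE.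
    by move=> _; apply: H; rewrite /= mem_index_enum.
  by apply: bigsetI_measurable => i _; apply: (measurable_funPTI (X i)).
- by move=> w /forallP H i _; apply: H.
rewrite le_eqVlt; apply/orP; left; apply/eqP.
apply: etrans (@indX [set: 'I_n]%SET (fun i => [set x | Q i x]) (fun i _ => mQ i)) _.
by rewrite -prodEFin; apply: eq_big => [i|i _]; [rewrite inE|have [_ ->] := Qq i].
Qed.

Lemma prod_lt_const (i : 'I_n) (f : R) : \prod_(k < n) (if (k < i)%N then f else 1) = f ^+ i.
Proof.
by rewrite -big_mkcond (big_ord_narrow (ltnW (ltn_ord i))) prodr_const card_ord.
Qed.

Lemma mean_le_none (F : pred (d.-tuple R)) f (j : 'I_n) : has_prob F f ->
  mean_le P (fun w => [forall k : 'I_n, (k < j)%N ==> F (X k w)]%:R) (f ^+ j).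
Proof.
move=> Ff; rewrite -prod_lt_const.
pose Q (k : 'I_n) := if (k < j)%N then F else xpredT.
have QE w : [forall k : 'I_n, (k < j)%N ==> F (X k w)] = [forall k, Q k (X k w)].
  by apply: eq_forallb => k; rewrite /Q; case: ifP.
under eq_fun do rewrite QE.
by apply: mean_le_forall => k; rewrite /Q; case: ifP => // _; apply: has_prob_true.
Qed.

(** As [i < j], the three conditions bear on disjoint sets of indices. This separates the survival
    of the [j]-th point from the records before it. *)
Lemma mean_le_none_two (E F S : pred (d.-tuple R)) e f s (i j : 'I_n) : (i < j)%N ->
  has_prob E e -> has_prob F f -> has_prob S s ->
  mean_le P (fun w => [&& E (X i w), [forall k : 'I_n, (k < i)%N ==> F (X k w)]
     & S (X j w)]%:R) (s * (e * f ^+ i)).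
Proof.
move=> ij Ee Ff Ss.
pose Q (k : 'I_n) := if k == j then S else if k == i then E else
  if (k < i)%N then F else xpredT.
pose q (k : 'I_n) := if k == j then s else if k == i then e else
  if (k < i)%N then f else 1.
have iNj : (i == j) = false by apply/eqP => eij; rewrite eij ltnn in ij.
have -> : s * (e * f ^+ i) = \prod_(k < n) q k.
  have qE k : q k = (if k == j then s else 1) *
      ((if k == i then e else 1) * (if (k < i)%N then f else 1)).
    rewrite /q; case: (eqVneq k j) => [->|_]; last first.
      by case: eqVneq => [->|_]; rewrite ?ltnn !(mul1r, mulr1).
    by rewrite eq_sym iNj ltnNge (ltnW ij) /= !mulr1.
  rewrite (eq_bigr _ (fun k _ => qE k)) !big_split /= prod_lt_const.
  by rewrite -!big_mkcond !big_pred1_eq.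
have QE w : [&& E (X i w), [forall k : 'I_n, (k < i)%N ==> F (X k w)]
     & S (X j w)] = [forall k, Q k (X k w)].
  apply/and3P/forallP => [[Ei /forallP Fk Sj] k|H].
    rewrite /Q; case: eqP => [->//|_]; case: eqP => [->//|_].
    by case: ifP => // ki; have := Fk k; rewrite ki.
  split; first by have := H i; rewrite /Q iNj eqxx.
    apply/forallP => k; apply/implyP => ki; have := H k; rewrite /Q ki.
    have -> : (k == j) = false by apply/eqP => kj; move: ki ij; rewrite kj; lia.
    by have -> : (k == i) = false by apply/eqP => kj; move: ki; rewrite kj ltnn.
  by have := H j; rewrite /Q eqxx.
under eq_fun do rewrite QE.
apply: mean_le_forall => k; rewrite /Q /q.
by case: ifP => // _; case: ifP => // _; case: ifP => // _; apply: has_prob_true.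
Qed.

End UniformSample.

(** * Records and survivors of the sieve *)

Section Dyadic.
Context (R : realType).

Definition half_pow (a : nat) : R := 2^-1 ^+ a.

Lemma half_pow_gt0 a : 0 < half_pow a. Proof. by rewrite exprn_gt0// invr_gt0. Qed.

Lemma half_pow_le1 a : half_pow a <= 1.
Proof. by apply: exprn_ile1; lra. Qed.

Lemma half_powS a : half_pow a.+1 = half_pow a / 2.
Proof. by rewrite /half_pow exprS mulrC. Qed.

(** Dyadic intervals shrinking towards 1. [cell a] has the same length as the interval [above a]
    that remains to its right, so a product of cells has the volume of the box dominating it. *)
Definition cell (a : nat) : interval R := `[1 - half_pow a, 1 - half_pow a.+1[.

Definition above (a : nat) : interval R := `[1 - half_pow a.+1, 1].

Lemma in_cell M (x : R) : 0 <= x < 1 - half_pow M -> exists a : 'I_M, x \in cell a.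
Proof.
elim: M => [|M IH] /andP[x0 xM]; first by move: xM; rewrite /half_pow expr0; lra.
have [xM'|xM'] := ltP x (1 - half_pow M).
  have [|a xa] := IH; first by rewrite x0.
  by exists (widen_ord (leqnSn M) a).
by exists ord_max; rewrite in_itv /= xM' xM.
Qed.

Lemma cell01 a (x : R) : x \in cell a -> 0 <= x <= 1.
Proof.
rewrite in_itv /= => /andP[]; have := half_pow_le1 a; have := half_pow_gt0 a.+1; lra.
Qed.

Lemma above01 a (x : R) : x \in above a -> 0 <= x <= 1.
Proof. rewrite in_itv /= => /andP[]; have := half_pow_le1 a.+1; lra. Qed.

Lemma lebesgue_itv_cc (b c : R) : b <= c -> lebesgue_measure `[b, c] = (c - b)%:E.
Proof.
move=> bc; rewrite lebesgue_measure_itv /= lte_fin; case: ltP => [_|cb]; first by rewrite EFinB.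
by rewrite (@le_anti _ _ b c) ?subrr// bc.
Qed.

Lemma lebesgue_itv_co (b c : R) : lebesgue_measure `[b, c[ = (Num.max 0 (c - b))%:E.
Proof.
rewrite lebesgue_measure_itv /= lte_fin; case: ltP => [bc|cb].
  by rewrite -EFinB max_r// subr_ge0 ltW.
by rewrite max_l// subr_le0.
Qed.

Lemma lebesgue_cell a : lebesgue_measure [set` cell a] = (half_pow a.+1)%:E.
Proof.
rewrite lebesgue_itv_co half_powS max_r; first by congr EFin; lra.
by have := half_pow_gt0 a; lra.
Qed.

Lemma lebesgue_above a : lebesgue_measure [set` above a] = (half_pow a.+1)%:E.
Proof.
have := half_pow_gt0 a.+1 => h.
by rewrite lebesgue_itv_cc; [congr EFin; lra | lra].
Qed.

Lemma prec_above d (phi : 'I_d -> nat) (x y : d.-tuple R) : (0 < d)%N ->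
  in_box (cell \o phi) x -> in_box (above \o phi) y -> prec x y.
Proof.
move=> d0 /forallP xc /forallP ya.
have xy l : tnth x l < tnth y l.
  have := xc l; have := ya l; rewrite /= !in_itv /= => /andP[ya1 _] /andP[_ xc1].
  exact: lt_le_trans xc1 ya1.
apply/andP; split; first by apply/forallP => l; apply: ltW.
by apply/eqP => exy; have := xy (Ordinal d0); rewrite exy ltxx.
Qed.

Lemma geometric_sum_le1 (v : R) n : 0 <= v <= 1 -> \sum_(i < n) v * (1 - v) ^+ i <= 1.
Proof.
move=> /andP[v0 v1]; rewrite -mulr_sumr.
have -> : v * (\sum_(i < n) (1 - v) ^+ i) = 1 - (1 - v) ^+ n.
  by rewrite -[RHS]opprB subrX1; ring.
by rewrite gerBl exprn_ge0// subr_ge0.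
Qed.

Lemma bernoulli_le (x : R) n : 0 <= x <= 1 -> 1 - (1 - x) ^+ n <= n%:R * x.
Proof.
move=> /andP[x0 x1]; elim: n => [|n IH]; first by rewrite expr0; lra.
have : 0 <= (1 - x) ^+ n by rewrite exprn_ge0// subr_ge0.
have : (1 - x) ^+ n <= 1 by rewrite exprn_ile1// ?subr_ge0// gerBl.
rewrite exprS -natr1; nra.
Qed.

End Dyadic.

(** * Mean number of records when a point may survive the sieve *)

Section RecordsAndSieve.
Context (R : realType) (dO : measure_display) (Omega : measurableType dO)
  (P : probability Omega R) (d n : nat) (X : 'I_n -> {RV P >-> d.-tuple R}).
Hypothesis (d_gt0 : (0 < d)%N) (indX : mutually_independent X)
  (unifX : forall i, uniform_on_cube (X i)).

Definition is_record (i : 'I_n) w : bool :=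
  [forall k : 'I_n, (k < i)%N ==> ~~ prec (X i w) (X k w)].

(** Used with two widths: 2^-M for the region covered by the first M dyadic cells in each
    coordinate, and d t for the region where the sieve discards. The width may exceed 1; the box is
    then empty, hence the maximum with 0 in its volume. *)
Definition corner (x : R) : 'I_d -> interval R := fun=> `[0, 1 - x[.

Lemma has_prob_corner (x : R) : 0 <= x ->
  has_prob X (in_box (corner x)) (Num.max 0 (1 - x) ^+ d).
Proof.
move=> x0; rewrite -[X in _ ^+ X]card_ord -prodr_const.
apply: has_prob_box => // l => [y|]; first by rewrite in_itv /= => /andP[y0 y1]; apply/andP; split; lra.
by rewrite lebesgue_itv_co subr0.
Qed.

Lemma corner_complement_le (x : R) : 0 <= x -> 1 - Num.max 0 (1 - x) ^+ d <= d%:R * x.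
Proof.
move=> x0; case: (lerP x 1) => [x1|/ltW x1].
  by rewrite max_r ?subr_ge0// bernoulli_le ?x0.
rewrite max_l ?subr_le0// expr0n eqn0Ngt d_gt0 subr0.
apply: le_trans x1 _; rewrite ler_peMl// ler1n//.
Qed.

(* A record in the dyadic cell phi leaves the box of points dominating that cell,
   which has the same volume v as the cell, empty so far; hence the i-th point is such
   a record with probability at most v (1 - v)^i, and these sum to at most 1. *)
Lemma mean_le_records M (S : pred (d.-tuple R)) (s : R) (j : 'I_n) : 0 <= s ->
  has_prob X S s ->
  mean_le P (fun w => \sum_(i < n | (i < j)%N) (is_record i w && S (X j w))%:R)
    (s * (M%:R ^+ d + n%:R * (d%:R * half_pow R M))).
Proof.
move=> s0 Ss.
pose v (phi : {ffun 'I_d -> 'I_M}) := \prod_(l < d) half_pow R (phi l).+1.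
have v01 phi : 0 <= v phi <= 1.
  rewrite prodr_ge0 /=; last by move=> l _; apply/ltW/half_pow_gt0.
  apply: prodr_ile1 => l _.
  by rewrite half_pow_le1 (ltW (half_pow_gt0 _ _)).
pose I (phi : {ffun 'I_d -> 'I_M}) l := cell R (phi l).
pose J (phi : {ffun 'I_d -> 'I_M}) l := above R (phi l).
have PI phi : has_prob X (in_box (I phi)) (v phi).
  by apply: has_prob_box => // l => [x /cell01//|]; apply: lebesgue_cell.
have PJ phi : has_prob X (predC (in_box (J phi))) (1 - v phi).
  apply: has_probN; apply: has_prob_box => // l => [x /above01//|].
  exact: lebesgue_above.
have hM0 : 0 <= half_pow R M by apply/ltW/half_pow_gt0.
pose r := 1 - Num.max 0 (1 - half_pow R M) ^+ d.
have Pr : has_prob X (predC (in_box (corner (half_pow R M)))) r.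
  exact/has_probN/has_prob_corner.
have rle : r <= d%:R * half_pow R M by exact: corner_complement_le.
have PT := has_prob_true X.
pose ev phi i w := [&& in_box (I phi) (X i w),
  [forall k : 'I_n, (k < i)%N ==> predC (in_box (J phi)) (X k w)] & S (X j w)].
(* Points outside all M^d cells are counted whether or not they are records: each occurs with
   probability at most d 2^-M. *)
pose rest i w := [&& predC (in_box (corner (half_pow R M))) (X i w),
  [forall k : 'I_n, (k < i)%N ==> xpredT (X k w)] & S (X j w)].
apply: (@mean_le_mono _ _ _ _ _ (fun w => \sum_(i < n | (i < j)%N)
   (\sum_phi (ev phi i w)%:R + (rest i w)%:R))
   (\sum_(i < n | (i < j)%N)
     (\sum_phi s * (v phi * (1 - v phi) ^+ i) + s * (r * 1 ^+ i)))).
- move=> w; apply: ler_sum => i ij.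
  have sum_ge0 : 0 <= \sum_phi (ev phi i w)%:R :> R by apply: sumr_ge0.
  case: (boolP (is_record i w && _)) => [/andP[rec Sj]|_]; last by rewrite addr_ge0.
  case: (boolP (in_box (corner (half_pow R M)) (X i w))) => [/forallP inC|ninC]; last first.
    suff -> : rest i w by rewrite lerDr.
    by rewrite /rest /= ninC Sj andbT; apply/forallP => k; apply/implyP.
  have /fin_all_exists[phi phiP] : forall l, exists a : 'I_M, tnth (X i w) l \in cell R a.
    by move=> l; apply: in_cell; have := inC l; rewrite in_itv.
  have ephi : ev [ffun l => phi l] i w.
    apply/and3P; split => //; first by apply/forallP => l; rewrite /I ffunE.
    apply/forallP => k; apply/implyP => ki; apply/negP => kJ.
    have /forallP/(_ k) := rec; rewrite ki /= => /negP; apply.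
    apply: (@prec_above _ _ (fun l => [ffun l => phi l] l)) kJ => //.
    by apply/forallP => l; rewrite /= ffunE.
  by rewrite (bigD1 [ffun l => phi l])//= ephi -addrA lerDl addr_ge0// sumr_ge0.
(* Summing over [i] first, each of the M^d cells contributes at most [s] by the geometric series. *)
- rewrite big_split /= exchange_big /= mulrDr; apply: lerD.
    apply: (@le_trans _ _ (\sum_(phi : {ffun 'I_d -> 'I_M}) s)); last first.
      by rewrite sumr_const card_ffun !card_ord -natrX mulr_natr.
    apply: ler_sum => phi _; rewrite -mulr_sumr ler_piMr//.
    apply: le_trans (geometric_sum_le1 n (v01 phi)).
    rewrite [leRHS](bigID (fun i : 'I_n => (i < j)%N)) /= lerDl sumr_ge0// => i _.
    by case/andP: (v01 phi) => *; rewrite mulr_ge0// exprn_ge0// subr_ge0.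
  have r0 : 0 <= r.
    have [_ /(_ j) E] := Pr; by rewrite -lee_fin -E measure_ge0.
  apply: (@le_trans _ _ (\sum_(i < n) s * (d%:R * half_pow R M))); last first.
    by rewrite sumr_const card_ord -[leLHS]mulr_natl mulrCA.
  rewrite big_mkcond; apply: ler_sum => i _; case: ifP => _; last by rewrite !mulr_ge0.
  by rewrite expr1n mulr1 ler_wpM2l.
- apply: mean_le_sum => i ij; apply: mean_leD.
    by apply: mean_le_sum => phi _; apply: mean_le_none_two.
  exact: mean_le_none_two.
Qed.

Definition in_cube : pred (d.-tuple R) := in_box (fun=> `[0, 1]).

Definition near_corner (t : R) : pred (d.-tuple R) := in_box (fun=> `[1 - t, 1]).

(** The last alternative is a null event: the points lie in the cube only almost surely, while the
    domination argument is made for every outcome. *)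
Definition sieve_bad (t : R) (j : 'I_n) w : bool :=
  [|| ~~ in_box (corner (d%:R * t)) (X j w),
      [forall k : 'I_n, (k < j)%N ==> predC (near_corner t) (X k w)] |
      [exists k : 'I_n, ~~ in_cube (X k w)]].

Lemma has_prob_in_cube : has_prob X in_cube 1.
Proof.
rewrite -(expr1n _ d) -[X in _ ^+ X]card_ord -prodr_const.
apply: has_prob_box => [//|l y|l]; first by rewrite in_itv.
by rewrite lebesgue_itv_cc ?subr0.
Qed.

Lemma has_prob_near_corner t : 0 <= t <= 1 -> has_prob X (near_corner t) (t ^+ d).
Proof.
move=> /andP[t0 t1]; rewrite -[X in _ ^+ X]card_ord -prodr_const.
apply: has_prob_box => // l => [y|]; first by rewrite in_itv /= => /andP[y0 y1]; apply/andP; split; lra.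
by rewrite lebesgue_itv_cc; [congr EFin; lra|lra].
Qed.

(** The alternatives of [sieve_bad] are treated separately: the first is independent of the records
    before [j]; in the second the number of records is bounded by [n]; the third has probability
    0. *)
Lemma mean_le_bad M t (j : 'I_n) : 0 <= t <= 1 ->
  mean_le P (fun w => (sieve_bad t j w)%:R * \sum_(i < n | (i < j)%N) (is_record i w)%:R)
   (d%:R * (d%:R * t) * (M%:R ^+ d + n%:R * (d%:R * half_pow R M))
    + n%:R * (1 - t ^+ d) ^+ j).
Proof.
move=> /andP[t0 t1]; have dt0 : 0 <= d%:R * t by rewrite mulr_ge0.
pose S := predC (in_box (corner (d%:R * t))).
pose s := 1 - Num.max 0 (1 - d%:R * t) ^+ d.
have Ss : has_prob X S s by exact/has_probN/has_prob_corner.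
have s0 : 0 <= s by have [_ /(_ j) E] := Ss; rewrite -lee_fin -E measure_ge0.
have sle : s <= d%:R * (d%:R * t) by exact: corner_complement_le.
have hM0 : 0 <= half_pow R M by apply/ltW/half_pow_gt0.
pose none w := [forall k : 'I_n, (k < j)%N ==> predC (near_corner t) (X k w)].
pose outside : pred (d.-tuple R) := predC in_cube.
apply: (@mean_le_mono _ _ _ _ _ (fun w =>
   (\sum_(i < n | (i < j)%N) (is_record i w && S (X j w))%:R + n%:R * (none w)%:R)
   + n%:R * \sum_(k < n) [forall l : 'I_n,
       (if l == k then outside else xpredT) (X l w)]%:R)
  ((s * (M%:R ^+ d + n%:R * (d%:R * half_pow R M)) + n%:R * (1 - t ^+ d) ^+ j)
   + n%:R * \sum_(k < n) 0)).
- move=> w; set K := \sum_(i < n | _) (is_record i w)%:R.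
  have K0 : 0 <= K by apply: sumr_ge0.
  have Kn : K <= n%:R.
    rewrite -[X in _ <= X%:R]card_ord -sumr_const /K big_mkcond; apply: ler_sum => i _.
    by case: ifP => // _; case: is_record.
  have sum1 : 0 <= \sum_(i < n | (i < j)%N) (is_record i w && S (X j w))%:R :> R.
    by apply: sumr_ge0.
  have sum2 : 0 <= \sum_(k < n) [forall l : 'I_n,
       (if l == k then outside else xpredT) (X l w)]%:R :> R.
    by apply: sumr_ge0.
  case: (boolP (sieve_bad t j w)) => [|_]; last first.
    by rewrite mul0r !addr_ge0 ?mulr_ge0.
  rewrite mul1r => /or3P[Sj|nj|/existsP[k ck]].
  + rewrite -addrA; apply: (@le_trans _ _ (\sum_(i < n | (i < j)%N)
      (is_record i w && S (X j w))%:R)); last by rewrite lerDl addr_ge0 ?mulr_ge0.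
    by apply: ler_sum => i _; rewrite /S /= Sj andbT.
  + rewrite /none nj mulr1; apply: le_trans Kn _.
    by rewrite addrAC lerDr addr_ge0 ?mulr_ge0.
  + apply: le_trans Kn _; apply: (@le_trans _ _ (n%:R * \sum_(k < n) [forall l : 'I_n,
       (if l == k then outside else xpredT) (X l w)]%:R)); last first.
      by rewrite lerDr addr_ge0 ?mulr_ge0.
    rewrite ler_peMr// (bigD1 k)//=.
    have -> : [forall l : 'I_n, (if l == k then outside else xpredT) (X l w)].
      by apply/forallP => l; case: eqP => [->|].
    by rewrite lerDl sumr_ge0.
- rewrite big1// mulr0 addr0 lerD2r ler_wpM2r// addr_ge0 ?exprn_ge0 ?mulr_ge0//.
- apply: mean_leD; last apply: mean_leZ => //.
    apply: mean_leD; first exact: mean_le_records.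
    apply: mean_leZ => //; apply: mean_le_none => //.
    by apply: has_probN; apply: has_prob_near_corner; rewrite t0.
  apply: mean_le_sum => k _.
  (* The factor at [k] is the probability [1 - 1] of leaving the cube, which gives 0 the product
     form of [mean_le_forall]. *)
  have -> : (0 : R) = \prod_(l < n) (if l == k then 1 - 1 else 1).
    by rewrite (bigD1 k)//= eqxx subrr mul0r.
  apply: (mean_le_forall indX (Q := fun l => if l == k then outside else xpredT)
    (q := fun l => if l == k then 1 - 1 else 1)) => l; case: ifP => _; last exact: has_prob_true.
  exact/has_probN/has_prob_in_cube.
Qed.

(* The sieve point has the largest L1-norm so far, at least that of a point of
   [near_corner t], so all its coordinates are at least 1 - d t. *)
Lemma sieve_bad_hyp (t : nat -> R) w : (forall j, 0 <= t j <= 1) ->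
  sieve_hyp [seq X i w | i <- enum 'I_n]
    (fun j => if insub j is Some j' then sieve_bad (t j) j' w else false).
Proof.
set ps := map _ _; move=> t01.
have nthE (j : 'I_n) : nth [tuple 0 | _ < d] ps j = X j w.
  by rewrite (nth_map j) ?size_enum_ord// nth_ord_enum.
have size_ps : size ps = n by rewrite size_map size_enum_ord.
have takeP (j : 'I_n) x : x \in take j ps -> exists2 k : 'I_n, (k < j)%N & x = X k w.
  move=> /(nthP [tuple 0 | _ < d])[k]; rewrite size_take size_ps ltn_ord => kj <-.
  by exists (Ordinal (ltn_trans kj (ltn_ord j))) => //; rewrite nth_take// -nthE.
have mem_takeX (j k : 'I_n) : (k < j)%N -> X k w \in take j ps.
  move=> kj; rewrite -nthE -(nth_take _ kj) mem_nth// size_take size_ps ltn_ord//.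
move=> j /andP[j0]; rewrite size_ps => jn.
case: insubP => [j' _ j'E|]; last by rewrite jn.
rewrite -j'E nthE => /norP[/negPn/forallP inC /norP[/forallPn[k knear] /existsPn cube]].
have {}cube k' l : 0 <= tnth (X k' w) l <= 1.
  by have /negPn/forallP/(_ l) := cube k'; rewrite in_itv.
split; first by move=> x /takeP[k' _ ->] l; case/andP: (cube k' l).
move=> s /takeP[m _ ->] smax.
move: knear; rewrite negb_imply => /andP[kj /negPn/forallP knear].
have tj := t01 j'.
have norm_k : d%:R * (1 - t j') <= l1norm (X k w).
  rewrite /l1norm -[X in X%:R * _]card_ord mulr_natl -sumr_const; apply: ler_sum => l _.
  rewrite ger0_norm; last by case/andP: (cube k l).
  by have := knear l; rewrite in_itv /= => /andP[].
have xs l : tnth (X j' w) l < tnth (X m w) l.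
  have := inC l; rewrite in_itv /= => /andP[_ xl]; apply: lt_le_trans xl _.
  have := smax _ (mem_takeX _ _ kj); rewrite {2}/l1norm (bigD1 l)//= => le2.
  (* The other coordinates sum to at most d - 1, so a norm of at least d (1 - t) leaves at least 1 -
     d t for coordinate [l]. *)
  have : \sum_(i < d | i != l) `|tnth (X m w) i| <= d%:R - 1.
    apply: (@le_trans _ _ (\sum_(i < d | i != l) 1)).
      by apply: ler_sum => i _; case/andP: (cube m i) => *; rewrite ger0_norm.
    have : \sum_(i < d) (1 : R) = d%:R by rewrite sumr_const card_ord.
    by rewrite (bigD1 l)//= => <-; lra.
  move: le2 norm_k; rewrite ger0_norm; last by case/andP: (cube m l).
  lra.
apply/andP; split; first by apply/forallP => l; apply: ltW.
by apply/eqP => E; have := xs (Ordinal d_gt0); rewrite E ltxx.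
Qed.

End RecordsAndSieve.

(** * Asymptotic estimates *)

Section Estimates.
Context (R : realType).

(** Induction with m = n + 1: the step amounts to n^(1-a) <= m^(1-a) (1 - 1/(2m)). Since 1 - a >=
    1/2, it follows from sqrt(1 - 1/m) <= 1 - 1/(2m). *)
Lemma sum_powRN_le (a : R) n : 0 <= a <= 2^-1 ->
  \sum_(1 <= j < n.+1) j%:R `^ (- a) <= 2 * n%:R `^ (1 - a).
Proof.
move=> /andP[a0 a1]; elim: n => [|n IH].
  by rewrite big_geq// mulr_ge0// powR_ge0.
rewrite big_nat_recr//=; apply: le_trans (lerD IH (lexx _)) _.
set m : R := n.+1%:R.
have m0 : 0 < m by rewrite ltr0n.
have nm : n%:R = m - 1 :> R by rewrite /m -natr1 addrK.
have mE : m `^ (- a) = m `^ (1 - a) / m.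
  by rewrite (@powRD _ m 1 (- a)) ?(gt_eqF m0) ?implybT// powRr1 ?ltW// mulrAC divff ?gt_eqF// mul1r.
have ratio : n%:R `^ (1 - a) <= m `^ (1 - a) * (1 - (2 * m)^-1).
  have m1 : 1 <= m by rewrite /m ler1n.
  have im1 : m^-1 <= 1 by rewrite invf_le1.
  have hm : 0 <= 1 - (2 * m)^-1.
    by rewrite subr_ge0 invf_le1 ?mulr_gt0//; lra.
  case: (posnP n) => [n0|n0].
    rewrite n0 powR0; last by rewrite gt_eqF//; lra.
    by rewrite mulr_ge0 ?powR_ge0.
  set q := n%:R / m.
  have qE : q = 1 - m^-1 by rewrite /q nm mulrBl divff ?gt_eqF// mul1r.
  have q0 : 0 < q by rewrite divr_gt0// ltr0n.
  have q1 : q <= 1 by rewrite qE gerBl invr_ge0 ltW.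
  rewrite (_ : n%:R = m * q); last by rewrite /q mulrCA divff ?gt_eqF// mulr1.
  rewrite powRM ?(ltW m0) ?(ltW q0)// ler_wpM2l ?powR_ge0//.
  apply: (@le_trans _ _ (q `^ 2^-1)).
    by apply: ger_powR; [rewrite q0|lra].
  rewrite powR12_sqrt ?(ltW q0)//.
  rewrite -(ger0_norm hm) -sqrtr_sqr ler_sqrt ?sqr_ge0// qE invfM.
  have -> : (1 - 2^-1 * m^-1) ^+ 2 = 1 - m^-1 + (m^-1) ^+ 2 / 4.
    by move: (m^-1) => y; field.
  by rewrite lerDl divr_ge0 ?sqr_ge0.
rewrite mE; move: ratio; rewrite invfM mulrBr mulr1 => ratio.
have -> : m `^ (1 - a) / m = 2 * (m `^ (1 - a) * (2^-1 * m^-1)).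
  by move: (m^-1) => y; field.
by move: ratio; clearbody m; lra.
Qed.

Lemma one_sub_exp_le (L : R) (j : nat) : (0 < j)%N -> L <= j%:R ->
  (1 - L / j%:R) ^+ j <= expR (- L).
Proof.
move=> j0 Lj; have j0' : 0 < j%:R :> R by rewrite ltr0n.
have -> : expR (- L) = expR (- (L / j%:R)) ^+ j.
  by rewrite -expRM_natl mulrN mulrCA divff ?gt_eqF// mulr1.
apply: lerXn2r; rewrite ?nnegrE ?expR_ge0 ?expR_ge1Dx//.
by rewrite subr_ge0 ler_pdivrMr// mul1r.
Qed.

(** Below the cap, the d-th power of the width is 2 ln n / j; the cap keeps the box near the corner
    inside the cube. *)
Definition sieve_width d n (j : nat) : R :=
  Num.min 1 ((2 * ln n%:R / j%:R) `^ d%:R^-1).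

Lemma sieve_width01 d n j : 0 <= sieve_width d n j <= 1.
Proof. by rewrite le_min ler01 powR_ge0 ge_min lexx. Qed.

(** The factor 2 in the width gives exp(-2 ln n) = n^-2: one power of n cancels the bound [n] on the
    number of records, the other makes the sum over [j] bounded. At the cap the left side is 0. *)
Lemma sieve_width_empty d n j : (0 < d)%N -> (0 < n)%N -> (0 < j)%N ->
  n%:R * (1 - sieve_width d n j ^+ d) ^+ j <= n%:R^-1 :> R.
Proof.
move=> d0 n0 j0; have n0' : 0 < n%:R :> R by rewrite ltr0n.
have L0 : 0 <= ln n%:R :> R by rewrite ln_ge0// ler1n.
rewrite -[leRHS]mulr1 ler_pdivlMl// mulrA.
suff H : (1 - sieve_width d n j ^+ d) ^+ j <= expR (- (2 * ln n%:R)) :> R.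
  rewrite -[leRHS](expRxMexpNx_1 (2 * ln n%:R)).
  have -> : expR (2 * ln n%:R) = n%:R * n%:R :> R.
    by rewrite mulr_natl mulr2n expRD lnK.
  by rewrite ler_wpM2l// mulr_ge0.
rewrite /sieve_width minEle; case: ifP => [_|/negbT].
  by rewrite expr1n subrr expr0n eqn0Ngt j0 expR_ge0.
rewrite -ltNge => lt1.
have x0 : 0 <= 2 * ln n%:R / j%:R :> R by rewrite divr_ge0// mulr_ge0.
have E : ((2 * ln n%:R / j%:R) `^ d%:R^-1) ^+ d = 2 * ln n%:R / j%:R :> R.
  by rewrite -powR_mulrn ?powR_ge0// -powRrM mulVf ?powRr1// pnatr_eq0 -lt0n.
rewrite E; apply: one_sub_exp_le => //.
rewrite -[leRHS]mul1r -ler_pdivrMr ?ltr0n// -E exprn_ile1 ?powR_ge0// ltW//.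
Qed.

(** The constant 4 combines 2^(1/d) <= 2 with the 2 of [sum_powRN_le], which applies because 1/d <=
    1/2. *)
Lemma sum_sieve_width d n : (2 <= d)%N -> (0 < n)%N ->
  \sum_(1 <= j < n) sieve_width d n j <=
    4 * ln n%:R `^ d%:R^-1 * n%:R `^ (1 - d%:R^-1).
Proof.
move=> d2 n0; set a := d%:R^-1.
have L0 : 0 <= ln n%:R :> R by rewrite ln_ge0// ler1n.
have a0 : 0 <= a by rewrite invr_ge0.
have a1 : a <= 2^-1 by rewrite lef_pV2 ?posrE ?ltr0n ?ler_nat//; lia.
apply: (@le_trans _ _ (\sum_(1 <= j < n.+1) (2 * ln n%:R `^ a) * j%:R `^ (- a))).
  rewrite big_nat_recr//= -[leLHS]addr0; apply: lerD; last first.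
    by rewrite !mulr_ge0 ?powR_ge0.
  apply: ler_sum => j _; rewrite ge_min; apply/orP; right.
  rewrite powRM ?mulr_ge0 ?invr_ge0// powRM//.
  rewrite -[j%:R^-1]powR_inv1// -powRrM mulN1r ler_wpM2r ?powR_ge0//.
  by rewrite ler_wpM2r ?powR_ge0// ler1_powR ?ler1n// (le_trans a1)// invf_le1 ?ler1n.
have := @sum_powRN_le a n; rewrite a0 a1 => /(_ isT) H.
rewrite -mulr_sumr; apply: le_trans (ler_wpM2l _ H) _.
  by rewrite mulr_ge0 ?powR_ge0.
by rewrite le_eqVlt; apply/orP; left; apply/eqP; ring.
Qed.

(** From ln(1 - 1/2) <= -1/2. It explains the threshold n >= 4: from there on ln n >= 1 absorbs
    constants. *)
Lemma ln4_ge1 : 1 <= ln 4 :> R.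
Proof.
have := @le_ln1Dx R (- 2^-1).
have -> : 1 + - 2^-1 = 2^-1 :> R by lra.
rewrite lnV ?posrE// => /(_ ltac:(lra)) h.
rewrite (_ : 4 = 2 * 2 :> R); last by ring.
by rewrite lnM ?posrE//; lra.
Qed.

(** With m = [up_log 2 n] - 1, 2^m < n and ln 2 >= 1/2 give m <= 2 ln n; the missing 1 is at most ln
    n. *)
Lemma up_log_le n : (4 <= n)%N -> (up_log 2 n)%:R <= 3 * ln n%:R :> R.
Proof.
move=> n4; have n0 : 0 < n%:R :> R by rewrite ltr0n; lia.
have L1 : 1 <= ln n%:R :> R.
  by apply: le_trans ln4_ge1 _; rewrite ler_ln ?posrE// ?ler_nat.
have := @up_log_gtn 2 n isT; rewrite (leq_trans _ n4)// => /(_ isT).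
have -> : (up_log 2 n)%:R = (up_log 2 n).-1%:R + 1 :> R.
  by rewrite natr1 prednK// up_log_gt0 /=; lia.
set m := (up_log 2 n).-1 => lt.
have : m%:R * ln 2 <= ln n%:R :> R.
  rewrite mulr_natl -lnXn// ler_ln ?posrE ?exprn_gt0// -natrX ler_nat ltnW//.
have := ln4_ge1; rewrite (_ : 4 = 2 * 2 :> R); last by ring.
rewrite lnM ?posrE// => l2 ml.
have hm : m%:R * 2^-1 <= m%:R * ln 2 :> R by rewrite ler_wpM2l//; lra.
lra.
Qed.

(** The choice M = [up_log 2 n] makes n 2^-M <= 1, so the points outside the cells contribute at
    most [d], while M stays of order ln n. *)
Lemma records_bound_le d n : (4 <= n)%N ->
  (up_log 2 n)%:R ^+ d + n%:R * (d%:R * half_pow R (up_log 2 n))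
    <= (3 ^+ d + d%:R) * ln n%:R `^ d%:R :> R.
Proof.
move=> n4; have n0 : 0 < n%:R :> R by rewrite ltr0n; lia.
have L1 : 1 <= ln n%:R :> R.
  by apply: le_trans ln4_ge1 _; rewrite ler_ln ?posrE// ?ler_nat.
have L0 := le_trans ler01 L1.
rewrite powR_mulrn// mulrDl; apply: lerD.
  by rewrite -exprMn lerXn2r ?nnegrE ?mulr_ge0// up_log_le.
rewrite mulrCA ler_wpM2l// (@le_trans _ _ 1)// ?exprn_ege1//.
rewrite /half_pow exprVn ler_pdivrMr ?exprn_gt0// mul1r -natrX ler_nat.
exact: up_logP.
Qed.

End Estimates.

(** * Mean cost on a uniform sample *)

Section MeanCost.
Context (R : realType) (dO : measure_display) (Omega : measurableType dO)
  (P : probability Omega R) (d n : nat) (X : 'I_n -> {RV P >-> d.-tuple R}).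
Hypothesis (d_ge2 : (2 <= d)%N) (n_ge4 : (4 <= n)%N)
  (indX : mutually_independent X) (unifX : forall i, uniform_on_cube (X i)).

Let sample w : seq (d.-tuple R) := [seq X i w | i <- enum 'I_n].

Let sample_nth (j : 'I_n) w : nth [tuple 0 | _ < d] (sample w) j = X j w.
Proof. by rewrite (nth_map j) ?size_enum_ord// nth_ord_enum. Qed.

Let size_sample w : size (sample w) = n.
Proof. by rewrite size_map size_enum_ord. Qed.

Lemma record_sample (i : 'I_n) w : record (sample w) i -> is_record X i w.
Proof.
rewrite /record sample_nth => /hasPn H; apply/forallP => k; apply/implyP => ki.
apply: H; rewrite -sample_nth -(nth_take _ ki) mem_nth// size_take size_sample.
by rewrite ltn_ord.
Qed.

Lemma nrecords_sample (j : 'I_n) w : (nrecords (sample w) j)%:R <=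
  \sum_(i < n | (i < j)%N) (is_record X i w)%:R :> R.
Proof.
rewrite /nrecords natr_sum.
rewrite (big_ord_widen_cond n xpredT (fun i => (record (sample w) i)%:R))//=; last first.
  exact: ltnW.
apply: ler_sum => i _; rewrite ler_nat; have := @record_sample i w.
by case: record => // ->.
Qed.

Lemma mean_le_cost (t : nat -> R) M : (forall j, 0 <= t j <= 1) ->
  mean_le P (fun w => `|(sieve_maxima_comparisons (sample w))%:R - d%:R * n%:R|)
   ((12 * d + 5)%:R * (1 + \sum_(1 <= j < n)
     (d%:R * (d%:R * t j) * (M%:R ^+ d + n%:R * (d%:R * half_pow R M))
      + n%:R * (1 - t j ^+ d) ^+ j))).
Proof.
move=> t01.
apply: (@mean_le_mono _ _ _ _ _ (fun w => (12 * d + 5)%:R * (1 +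
  \sum_(j < n | xpredT j && (1 <= j)%N)
   (sieve_bad X (t j) j w)%:R * \sum_(i < n | (i < j)%N) (is_record X i w)%:R))) (lexx _) _.
  move=> w; have d0 : (0 < d)%N by lia.
  have := sieve_maxima_cost (sieve_bad_hyp (X := X) d0 (w := w) t01).
  rewrite -/(sample w) size_sample; set S := (\sum_(1 <= j < n) _)%N => -[up lo].
  apply: (@le_trans _ _ ((12 * d + 5) * (1 + S))%:R).
    rewrite -natrM ler_norml lerBlDr lerNl opprB lerBlDr -!natrD !ler_nat.
    by apply/andP; split; lia.
  rewrite natrM ler_wpM2l// natrD lerD2l natr_sum big_geq_mkord /=.
  apply: ler_sum => j _; rewrite insubT //= => jn.
  have -> : Sub (j : nat) jn = j by apply/val_inj.
  by rewrite natrM ler_wpM2l// nrecords_sample.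
rewrite big_geq_mkord.
apply: mean_leZ => //; apply: mean_leD; first exact: mean_le_cst.
apply: mean_le_sum => j _; apply: mean_le_bad => //; lia.
Qed.

Lemma cost_dist_le : mean_le P
  (fun w => `|(sieve_maxima_comparisons (sample w))%:R - d%:R * n%:R|)
  ((12 * d + 5)%:R * (2 + 4 * d%:R ^+ 2 * (3 ^+ d + d%:R)) *
    (n%:R `^ (1 - d%:R^-1) * ln n%:R `^ (d%:R + d%:R^-1))).
Proof.
have L1 : 1 <= ln n%:R :> R.
  by apply: le_trans (ln4_ge1 R) _; rewrite ler_ln ?posrE ?ler_nat// ltr0n; lia.
have n1 : 1 <= n%:R :> R by rewrite ler1n; lia.
have a1 : d%:R^-1 <= 1 :> R by rewrite invf_le1 ?ler1n ?ltr0n; lia.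
have a0 : 0 <= d%:R^-1 :> R by rewrite invr_ge0.
apply: mean_le_mono (mean_le_cost (up_log 2 n) (sieve_width01 R d n)) => //.
rewrite -mulrA ler_wpM2l// big_split/=.
set N := n%:R `^ _; set L := ln n%:R `^ (_ + _).
have N1 : 1 <= N by rewrite /N -[leLHS](powRr0 n%:R) ler_powR// subr_ge0.
have LL1 : 1 <= L by rewrite /L -[leLHS](powRr0 (ln n%:R)) ler_powR// addr_ge0.
have LE : L = ln n%:R `^ d%:R * ln n%:R `^ d%:R^-1.
  by rewrite /L powRD// (gt_eqF (lt_le_trans ltr01 L1)) implybT.
have S2 : \sum_(1 <= j < n) n%:R * (1 - sieve_width R d n j ^+ d) ^+ j <= 1 :> R.
  apply: (@le_trans _ _ (\sum_(1 <= j < n) n%:R^-1)).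
    rewrite big_nat_cond [leRHS]big_nat_cond; apply: ler_sum => j /andP[/andP[j0 _] _].
    by apply: sieve_width_empty; lia.
  rewrite sumr_const_nat -[leLHS]mulr_natl ler_pdivrMr ?(lt_le_trans ltr01 n1)// mul1r ler_nat.
  exact: leq_subr.
have S1 := sum_sieve_width R d_ge2 (ltac:(lia) : (0 < n)%N).
have S3 := records_bound_le R d n_ge4.
rewrite -/N in S1; move: S3; set B := (X in X <= _) => S3.
have B0 : 0 <= B.
  by rewrite addr_ge0 ?exprn_ge0// !mulr_ge0// ltW// half_pow_gt0.
(* Main term: [S1] sums the survival probabilities, [S3] bounds the mean number of records, and the
   exponents of ln n add up to d + 1/d. *)
have S4 : \sum_(1 <= j < n) d%:R * (d%:R * sieve_width R d n j) * B <=
    4 * d%:R ^+ 2 * (3 ^+ d + d%:R) * (N * L).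
  under eq_bigr do rewrite mulrA -expr2 mulrAC.
  rewrite -mulr_sumr.
  apply: (@le_trans _ _ (d%:R ^+ 2 * ((3 ^+ d + d%:R) * ln n%:R `^ d%:R) *
     (4 * ln n%:R `^ d%:R^-1 * N))).
    apply: ler_pM => //; first by rewrite mulr_ge0 ?exprn_ge0.
      by apply: sumr_ge0 => j _; case/andP: (sieve_width01 R d n j).
    by rewrite ler_wpM2l ?exprn_ge0.
  by rewrite LE le_eqVlt; apply/orP; left; apply/eqP; ring.
(* The 2 in the constant is the 1 of [mean_le_cost] plus the bound 1 of [S2], both absorbed by
   [N * L]. *)
have NL1 : 1 <= N * L by rewrite -[leLHS]mulr1 ler_pM.
rewrite mulrDl; apply: le_trans (lerD (lexx 1) (lerD S4 S2)) _.
lra.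
Qed.

End MeanCost.

Theorem theorem2 (R : realType) (d : nat) (hd : (2 <= d)%N) :
  exists C : R, \forall n \near \oo,
    forall (dO : measure_display) (Omega : measurableType dO)
      (P : probability Omega R) (p : 'I_n -> {RV P >-> d.-tuple R}),
    mutually_independent p ->
    (forall i : 'I_n, uniform_on_cube (p i)) ->
    (`| 'E_P[fun w => (sieve_maxima_comparisons
                         [seq p i w | i <- enum 'I_n])%:R]
        - (d%:R * n%:R)%:E |
     <= (C * (n%:R `^ (1 - d%:R^-1) * ln n%:R `^ (d%:R + d%:R^-1)))%:E)%E.
Proof.
exists ((12 * d + 5)%:R * (2 + 4 * d%:R ^+ 2 * (3 ^+ d + d%:R))).
exists 4%N => // n /= n4 dO Omega P p indp unifp.
apply: expectation_dist; [by move=> w; rewrite ler0n|by rewrite mulr_ge0|].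
exact: cost_dist_le.
Qed.
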